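(* Let $X$ be an infinite ultrahomogeneous chain with the order topology and $G=(\mathrm{Aut}(X),\tau_p)$. Then: (a) the Ellis compactification $e_{c_mX}G$ is the completion of $(G,R_{\Sigma_{c_mX}})$ (i.e. $\mathcal V_G=R_{\Sigma_{c_mX}}$); (b) $G$ is Roelcke precompact and $b_rG<e_{c_mX}G$ (strictly); (c) $e_{c_mX}G$ is the set of all non-decreasing maps $f:c_mX\to c_mX$ ($x<y\Rightarrow f(x)\leq f(y)$) with $f(\inf)=\inf$ and $f(\sup)=\sup$, with the topology of pointwise convergence. If moreover $X$ is continuously ordered, then $e_{c_mX}G$ is the completion of $(G,R_{\Sigma_X})$.
   Context: Ultrahomogeneous chain: for all $x_1<\dots<x_n$, $y_1<\dots<y_n$ there is an order automorphism with $g(x_k)=y_k$. $\tau_p$: topology of pointwise convergence. $c_mX$: $X$ plus one point per gap (cut $(A,B)$, $A<B$, $A$ without max, $B$ without min, including $\inf$ ($A=\emptyset$) and $\sup$ ($B=\emptyset$)), with order topology; $G$ acts on it by extension. For a compact $K$ on which $G$ acts, $e_KG$ is the closure of $\iota_K(G)$, $\iota_K(g)(x)=gx$, in $K^K$ (product topology), and $\mathcal V_G$ is the uniformity on $G$ transported from the subspace product uniformity on $\iota_K(G)$. For a $G$-set $Z$, $\mathrm{St}_\sigma=\{g: gz=z\ \forall z\in\sigma\}$ and $R_{\Sigma_Z}$ is the uniformity on $G$ with base covers $\{Og\,\mathrm{St}_\sigma:g\in G\}$, $O$ a neighbourhood of $e$, $\sigma\subset Z$ finite nonempty. Roelcke precompact: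 the uniformity with base covers $\{OgO: g\in G\}$ is totally bounded; $b_rG$ is then the completion of $G$ in it. Continuously ordered: densely ordered with no proper gaps. *)

(* Defs.v *)
From HB Require Import structures.
From mathcomp Require Import all_boot all_order.
From mathcomp Require Import boolp classical_sets cardinality.
Set Implicit Arguments. Unset Strict Implicit. Unset Printing Implicit Defensive.
Import Order.TTheory.
Local Open Scope classical_set_scope.
Local Open Scope order_scope.

Section Defs.
Context {d : Order.disp_t} (X : orderType d).

Definition is_aut (g : X -> X) : Prop := bijective g /\ {mono g : x y / x <= y}.
Definition Aut := {g : X -> X | is_aut g}.

Definition ultrahomogeneous : Prop :=
  forall s t : seq X, size s = size t -> sorted <%O s -> sorted <%O t ->
    exists g, is_aut g /\ map g s = t.

(** gaps, encoded by their lower part A (B is the complement) *)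
Definition isgap (A : set X) : Prop :=
  (forall x y, y <= x -> A x -> A y) /\
  (forall x, A x -> exists x', A x' /\ x < x') /\
  (forall x, ~ A x -> exists x', ~ A x' /\ x' < x).

(** points of c_m X, encoded as cuts: x is [set y | y <= x], a gap is A *)
Definition cmpt (L : set X) : Prop := (exists a, L = [set y | y <= a]) \/ isgap L.
Definition cm := {L : set X | cmpt L}.
Definition cm_of (x : X) : cm.
Proof. by exists [set y | y <= x]; left; exists x. Defined.
Definition ltcm (p q : cm) : Prop := proj1_sig p `<` proj1_sig q.
Definition lecm (p q : cm) : Prop := proj1_sig p `<=` proj1_sig q.

Lemma cmpt_img (g : Aut) (L : cm) : cmpt (proj1_sig g @` proj1_sig L).
Proof.
case: g => g [[gi gK giK] gm]; case: L => L /= [[a ->]|[dL [nM nm]]].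
- left; exists (g a); apply/seteqP; split => y /=.
    by case=> x /= xa <-; rewrite gm.
  by move=> ya; exists (gi y); rewrite ?giK // -gm giK.
- right; split; [|split].
  + move=> x y yx [z Lz gz]; exists (gi y); last by rewrite giK.
    apply: (dL z); last by []. by rewrite -gm giK gz.
  + move=> _ [x Lx <-]; have [x' [Lx' xx']] := nM x Lx.
    exists (g x'); split; first by exists x'.
    by rewrite !lt_neqAle gm (inj_eq (can_inj gK)) -lt_neqAle.
  + move=> y ny; have nL : ~ L (gi y) by move=> Ly; apply: ny; exists (gi y).
    have [x' [nLx' xx']] := nm _ nL; exists (g x'); split.
      by case=> z Lz /(can_inj gK) zx; apply: nLx'; rewrite -zx.
    have := xx'; rewrite !lt_neqAle -(gm x') giK.
    by rewrite -(inj_eq (can_inj gK)) giK.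
Qed.

Definition actcm (g : Aut) (p : cm) : cm := exist _ _ (cmpt_img g p).

Definition oint {T : Type} (lt : T -> T -> Prop) (a b : option T) (q : T) : Prop :=
  (forall a', a = Some a' -> lt a' q) /\ (forall b', b = Some b' -> lt q b').
Definition oopen {T : Type} (lt : T -> T -> Prop) (U : set T) : Prop :=
  forall p, U p -> exists a b, oint lt a b p /\ (forall q, oint lt a b q -> U q).

Definition nbhd_e (O : set Aut) : Prop :=
  exists (F : set X) (U : X -> set X), finite_set F /\
    (forall x, F x -> oopen <%O (U x) /\ U x x) /\
    (forall g : Aut, (forall x, F x -> U x (proj1_sig g x)) -> O g).

(** Ellis compactification e_K G: closure of iota_K(G) in K^K (product topology) *)
Definition Ellis {K : Type} (ltK : K -> K -> Prop) (act : Aut -> K -> K) : set (K -> K) :=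
  [set f | forall (F : set K) (U : K -> set K), finite_set F ->
     (forall p, F p -> oopen ltK (U p) /\ U p (f p)) ->
     exists g : Aut, forall p, F p -> U p (act g p)].

(** entourages of the (unique) uniformity of the compact space K:
    the neighbourhoods of the diagonal in K x K *)
Definition diag_nbhd {K : Type} (ltK : K -> K -> Prop) (D : set (K * K)) : Prop :=
  forall p, exists U V, oopen ltK U /\ oopen ltK V /\ U p /\ V p /\
    (forall q r, U q -> V r -> D (q, r)).

(** V_G: uniformity on G transported from the product uniformity on
    iota_K(G) subset K^K (as a set of entourages) *)
Definition Vunif {K : Type} (ltK : K -> K -> Prop) (act : Aut -> K -> K)
  : set (set (Aut * Aut)) :=
  [set W | exists (F : set K) (D : set (K * K)), finite_set F /\ diag_nbhd ltK D /\
     (forall g h : Aut, (forall p, F p -> D (act g p, act h p)) -> W (g, h))].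

Definition St {Z : Type} (act : Aut -> Z -> Z) (sigma : set Z) : set Aut :=
  [set g | forall z, sigma z -> act g z = z].
Definition in_OgS (O : set Aut) (k : Aut) (S : set Aut) (g : Aut) : Prop :=
  exists o s, O o /\ S s /\
    proj1_sig g = proj1_sig o \o proj1_sig k \o proj1_sig s.
Definition RSigma {Z : Type} (act : Aut -> Z -> Z) : set (set (Aut * Aut)) :=
  [set W | exists (O : set Aut) (sigma : set Z),
     nbhd_e O /\ finite_set sigma /\ sigma !=set0 /\
     (forall g h : Aut, (exists k, in_OgS O k (St act sigma) g /\
                                   in_OgS O k (St act sigma) h) -> W (g, h))].

(** Roelcke uniformity (base covers {OgO}) and Roelcke precompactness *)
Definition Roelcke : set (set (Aut * Aut)) :=
  [set W | exists O : set Aut, nbhd_e O /\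
     (forall g h : Aut, (exists k, in_OgS O k O g /\ in_OgS O k O h) -> W (g, h))].
Definition totally_bounded {T : Type} (U : set (set (T * T))) : Prop :=
  forall W, U W -> exists F : set T, finite_set F /\
    forall x, exists f, F f /\ W (f, x).
Definition Roelcke_precompact : Prop := totally_bounded Roelcke.

Definition continuously_ordered : Prop :=
  (forall x y : X, x < y -> exists z, x < z /\ z < y) /\
  (forall A : set X, isgap A -> A = set0 \/ A = setT).

End Defs.

(* Main.v *)
From HB Require Import structures.
Require Import Defs.
From mathcomp Require Import all_boot all_order.
From mathcomp Require Import boolp classical_sets cardinality.
Set Implicit Arguments.
Unset Strict Implicit.
Unset Printing Implicit Defensive.
Import Order.TTheory.
Local Open Scope classical_set_scope.
Local Open Scope order_scope.

(** The key step is a one-point extension property: if t is an automorphism, Q a finite set of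
cuts and x, y points of X lying in the same position relative to Q and t Q, then some
automorphism agrees with t on Q and sends x to y.  It is obtained by splicing a homogeneity
automorphism with the identity, so that gaps in Q stay fixed.  Iterating it moves finitely many
cuts into prescribed intervals while keeping t on Q.  Applied to t = h g^-1 this shows that
product-close pairs (g, h) are R_Sigma-close, and applied to t = id it approximates every
monotone self-map of the compact chain of cuts by automorphisms.  The converse comparison is
compactness: a neighbourhood of the identity moves all cuts uniformly little. *)

(** * The chain of cuts *)

Fact cm_display : Order.disp_t. Proof. exact: Order.Disp tt tt. Qed.

Section CmOrder.
Context {d : Order.disp_t} {X : orderType d}.
Implicit Types (p q r : cm X) (x y z : X).

Lemma cm_inj p q : proj1_sig p = proj1_sig q -> p = q.
Proof. by case: p q => [A hA] [B hB] /= AB; subst B; congr exist; exact: Prop_irrelevance. Qed.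

Lemma cm_down p x y : y <= x -> proj1_sig p x -> proj1_sig p y.
Proof.
case: p => A /= [[a ->]|[dA _]] /=; first exact: le_trans.
exact: dA.
Qed.

Definition cm_le p q : bool := `[< lecm p q >].

Fact cm_le_refl : reflexive cm_le.
Proof. by move=> p; apply/asboolP. Qed.

Fact cm_le_anti : antisymmetric cm_le.
Proof. by move=> p q /andP[/asboolP pq /asboolP qp]; apply/cm_inj/seteqP. Qed.

Fact cm_le_trans : transitive cm_le.
Proof. by move=> q p r /asboolP pq /asboolP qr; apply/asboolP; exact: subset_trans qr. Qed.

(** A point of q missing from p lies above every point of p, because both sets are closed
    downwards. *)
Fact cm_le_total : total cm_le.
Proof.
move=> p q; apply/orP; have [pq|npq] := pselect (lecm p q); [left|right]; apply/asboolP => //.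
move=> y qy; apply: contrapT => npy; apply: npq => x px.
have [xy|yx] := leP x y; first exact: cm_down qy.
by case: npy; apply: cm_down px; exact: ltW.
Qed.

HB.instance Definition _ := gen_eqMixin (cm X).
HB.instance Definition _ := gen_choiceMixin (cm X).
HB.instance Definition _ := @Order.Le_isPOrder.Build cm_display (cm X)
  cm_le cm_le_refl cm_le_anti cm_le_trans.
HB.instance Definition _ := @Order.POrder_isTotal.Build cm_display (cm X) cm_le_total.

Lemma lecmE p q : lecm p q <-> p <= q.
Proof. by split => [/asboolP|/asboolP]. Qed.

Lemma ltcmE p q : ltcm p q <-> p < q.
Proof.
rewrite /ltcm properEneq lt_neqAle; split.
  by move=> [/eqP npq /lecmE ->]; rewrite andbT; apply/eqP => pq; apply: npq; rewrite pq.
move=> /andP[/eqP npq /lecmE pq]; split=> //; apply/eqP => /cm_inj; exact: npq.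
Qed.

(** Dictionary between membership in a cut and the order on cuts; it turns later arguments about
    sets into order arguments. *)
Lemma cm_of_leP x p : cm_of x <= p <-> proj1_sig p x.
Proof.
rewrite -lecmE; split; first by apply; exact: lexx.
by move=> px y yx; exact: cm_down px.
Qed.

Lemma le_cm_of x y : (cm_of x <= cm_of y) = (x <= y).
Proof. by apply/idP/idP => [/cm_of_leP|xy] //; apply/cm_of_leP. Qed.

Lemma lt_cm_of x y : (cm_of x < cm_of y) = (x < y).
Proof. by rewrite !ltNge le_cm_of. Qed.

Lemma cm_of_inj : injective (@cm_of _ X).
Proof. by move=> x y /eqP; rewrite eq_le !le_cm_of -eq_le => /eqP. Qed.

(** The right inequality is weak because q may be the cut of x itself; [cm_dense] sharpens it once X
    is known to be dense. *)
Lemma lt_cm_witness p q : p < q -> exists x, p < cm_of x /\ cm_of x <= q.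
Proof.
rewrite ltNge => /negP nqp; apply: contrapT => nx; apply: nqp; apply/lecmE => x qx.
apply: contrapT => npx; apply: nx; exists x; split; last exact/cm_of_leP.
by rewrite ltNge; apply/negP => /cm_of_leP.
Qed.

End CmOrder.

(** * Order automorphisms *)

Section AutGroup.
Context {d : Order.disp_t} {X : orderType d}.
Implicit Types (g h t u : Aut X) (p q : cm X) (x y : X).

Lemma aut_le g x y : (proj1_sig g x <= proj1_sig g y) = (x <= y).
Proof. by case: g => g [gb gm] /=; rewrite gm. Qed.

Lemma aut_lt g x y : (proj1_sig g x < proj1_sig g y) = (x < y).
Proof. by rewrite !ltNge aut_le. Qed.

Lemma aut1_subproof : is_aut (@id X).
Proof. by split=> //; exists id. Qed.
Definition aut1 : Aut X := exist _ _ aut1_subproof.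

Lemma autM_subproof g h : is_aut (proj1_sig g \o proj1_sig h).
Proof.
case: g h => g [gb gm] [h [hb hm]] /=; split; first exact: bij_comp.
by move=> x y /=; rewrite gm hm.
Qed.
Definition autM g h : Aut X := exist _ _ (autM_subproof g h).

Lemma autV_exists g : exists h, cancel (proj1_sig g) (proj1_sig h) /\
  cancel (proj1_sig h) (proj1_sig g).
Proof.
case: g => g [[h gK hK] gm] /=.
have ha : is_aut h by split; [exists g | move=> x y; rewrite -gm !hK].
by exists (exist _ h ha).
Qed.
Definition autV g : Aut X := sval (cid (autV_exists g)).
Lemma autK g : cancel (proj1_sig g) (proj1_sig (autV g)).
Proof. exact: (svalP (cid (autV_exists g))).1. Qed.
Lemma autVK g : cancel (proj1_sig (autV g)) (proj1_sig g).
Proof. exact: (svalP (cid (autV_exists g))).2. Qed.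

Lemma act1 p : actcm aut1 p = p.
Proof. by apply: cm_inj => /=; exact: image_id. Qed.

Lemma actM g h p : actcm (autM g h) p = actcm g (actcm h p).
Proof. by apply: cm_inj => /=; rewrite image_comp. Qed.

Lemma act_eq g h : proj1_sig g =1 proj1_sig h -> actcm g =1 actcm h.
Proof. by move=> gh p; apply: cm_inj => /=; apply: eq_imagel => x _; exact: gh. Qed.

Lemma actK g : cancel (actcm g) (actcm (autV g)).
Proof. by move=> p; rewrite -actM (@act_eq _ aut1) ?act1// => x /=; rewrite autK. Qed.

Lemma act_le g p q : (actcm g p <= actcm g q) = (p <= q).
Proof.
have mono h r s : r <= s -> actcm h r <= actcm h s.
  by move=> /lecmE rs; apply/lecmE; exact: image_subset.
by apply/idP/idP => [/(mono (autV g))|/mono//]; rewrite !actK.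
Qed.

Lemma act_lt g p q : (actcm g p < actcm g q) = (p < q).
Proof. by rewrite !ltNge act_le. Qed.

Lemma act_cm_of g x : actcm g (cm_of x) = cm_of (proj1_sig g x).
Proof.
apply: cm_inj => /=; apply/seteqP; split => [_ /= [y yx <-]|y /= yx].
  by rewrite /= aut_le.
by exists (proj1_sig (autV g) y); rewrite ?autVK //= -(aut_le g) autVK.
Qed.

(* Splicing g with the identity outside [a, b] makes it fix the gaps outside [a, b]. *)
Lemma aut_splice g a b : proj1_sig g a = a -> proj1_sig g b = b ->
  exists h, (forall x, a <= x <= b -> proj1_sig h x = proj1_sig g x) /\
    (forall x, ~~ (a <= x <= b) -> proj1_sig h x = x).
Proof.
move=> ga gb; pose s (u : Aut X) x := if a <= x <= b then proj1_sig u x else x.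
(* An automorphism fixing a and b maps [a, b] onto itself, so splicing the inverse inverts the
   splice. *)
have rng (u : Aut X) x : proj1_sig u a = a -> proj1_sig u b = b ->
    (a <= proj1_sig u x <= b) = (a <= x <= b).
  by move=> ua ub; rewrite -(aut_le u a x) -(aut_le u x b) ua ub.
have sK (u v : Aut X) : proj1_sig u a = a -> proj1_sig u b = b ->
    cancel (proj1_sig u) (proj1_sig v) -> cancel (s u) (s v).
  move=> ua ub uv x; rewrite /s; case: (boolP (a <= x <= b)) => hx.
    by rewrite rng// hx uv.
  by rewrite (negbTE hx).
have va : proj1_sig (autV g) a = a by rewrite -{1}ga autK.
have vb : proj1_sig (autV g) b = b by rewrite -{1}gb autK.
have sa : is_aut (s g).
  split; first by exists (s (autV g)); [apply: sK => //; exact: autK | apply: sK => //;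
    exact: autVK].
  apply: le_mono => x y xy; rewrite /s.
  case: (boolP (a <= x <= b)) => hx; case: (boolP (a <= y <= b)) => hy //.
  - by rewrite aut_lt.
  - move: hy; rewrite negb_and -!ltNge => /orP[ya|]; last first.
      by apply: le_lt_trans; rewrite -gb aut_le; case/andP: hx.
    by case/andP: hx => ax _; have := lt_trans (le_lt_trans ax xy) ya; rewrite ltxx.
  - move: hx; rewrite negb_and -!ltNge => /orP[xa|bx].
      by apply: lt_le_trans xa _; rewrite -ga aut_le; case/andP: hy.
    by case/andP: hy => _ yb; have := lt_trans (lt_le_trans xy yb) bx; rewrite ltxx.
exists (exist _ _ sa); split => x hx /=; rewrite /s; first by rewrite hx.
by rewrite (negbTE hx).
Qed.

(** The cut has only points below a, all of them fixed. *)
Lemma act_fix_lt g a p : (forall x, x < a -> proj1_sig g x = x) ->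
  p < cm_of a -> actcm g p = p.
Proof.
move=> gE pa; have pE x : proj1_sig p x -> x < a.
  by move=> /cm_of_leP xp; rewrite -lt_cm_of; exact: le_lt_trans pa.
apply: cm_inj => /=; apply/seteqP; split => [_ /= [x px <-]|x px /=].
  by rewrite gE//; exact: pE.
by exists x => //; rewrite gE//; exact: pE.
Qed.

(** The cut contains the whole ray up to b, which g maps onto itself however it acts inside; the
    remaining points are fixed. *)
Lemma act_fix_gt g b p : (forall x, b < x -> proj1_sig g x = x) ->
  proj1_sig g b = b -> cm_of b < p -> actcm g p = p.
Proof.
move=> gE gb /ltW/cm_of_leP pb.
have low x : x <= b -> proj1_sig g x <= b by move=> xb; rewrite -gb aut_le.
apply: cm_inj => /=; apply/seteqP; split => [_ /= [x px <-]|x px /=].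
  have [xb|bx] := leP x b; last by rewrite gE.
  exact: cm_down (low _ xb) pb.
have [xb|bx] := leP x b; last by exists x => //; rewrite gE.
exists (proj1_sig (autV g) x); last exact: autVK.
by apply: cm_down pb; rewrite -(aut_le g) autVK gb.
Qed.

End AutGroup.

(** * Ultrahomogeneous chains *)

Section Homogeneous.
Context {d : Order.disp_t} {X : orderType d}.
Context (Xinf : infinite_set [set: X]) (Xuh : ultrahomogeneous X).
Implicit Types (g h t : Aut X) (p q : cm X) (x y : X).

Lemma uh_aut (s t : seq X) : size s = size t -> sorted <%O s -> sorted <%O t ->
  exists g : Aut X, map (proj1_sig g) s = t.
Proof. by move=> st /(Xuh st) h /h[g [ga gs]]; exists (exist _ g ga). Qed.

Lemma infinite_notin (s : seq X) : exists x, x \notin s.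
Proof.
apply: contrapT => ns; apply: Xinf; apply/finite_seqP; exists s.
apply/seteqP; split => // x _ /=; apply: contrapT => /negP xs; apply: ns; by exists x.
Qed.

(** Of two distinct points, the smaller is carried to x by homogeneity on one point, and the larger
    then lands above x. *)
Lemma uh_ltr x : exists y, x < y.
Proof.
have [a _] := infinite_notin [::]; have [b] := infinite_notin [:: a].
rewrite inE neq_lt => /orP[ba|ab].
  by have [g [gb]] := @uh_aut [:: b] [:: x] erefl isT isT; exists (proj1_sig g a);
    rewrite -gb aut_lt.
by have [g [gb]] := @uh_aut [:: a] [:: x] erefl isT isT; exists (proj1_sig g b); rewrite -gb aut_lt.
Qed.

Lemma uh_ltl x : exists y, y < x.
Proof.
have [a ax] := uh_ltr x.
have [g [gb]] := @uh_aut [:: a] [:: x] erefl isT isT; exists (proj1_sig g x).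
by rewrite -[X in _ < X]gb aut_lt.
Qed.

(** For z above y, an automorphism taking x, z to x, y puts the image of y strictly between. *)
Lemma uh_dense x y : x < y -> exists z, x < z /\ z < y.
Proof.
move=> xy; have [z yz] := uh_ltr y.
have [||g [gx gz]] := @uh_aut [:: x; z] [:: x; y] erefl; rewrite /= ?xy ?(lt_trans xy yz)//.
by exists (proj1_sig g y); rewrite -[X in X < _]gx -[X in _ /\ _ < X]gz !aut_lt.
Qed.

(** Absence of end points makes the two trivial cuts gaps; they are the points inf and sup of the
    completion. *)
Lemma isgap0 : isgap (@set0 X).
Proof.
split=> [x y _ []|]; split=> [x []|x _].
by have [y yx] := uh_ltl x; exists y; split => // -[].
Qed.

Lemma isgapT : isgap (@setT X).
Proof.
split=> //; split => [x _|x]; last by move=> /(_ I).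
by have [y yx] := uh_ltr x; exists y.
Qed.

Definition cm_bot : cm X := exist _ _ (or_intror isgap0).
Definition cm_top : cm X := exist _ _ (or_intror isgapT).

Lemma cm_bot_le p : cm_bot <= p.
Proof. by apply/lecmE => x. Qed.

Lemma cm_le_top p : p <= cm_top.
Proof. by apply/lecmE => x. Qed.

Lemma act_bot g : actcm g cm_bot = cm_bot.
Proof. by apply: cm_inj => /=; rewrite image_set0. Qed.

Lemma act_top g : actcm g cm_top = cm_top.
Proof. by apply: le_anti; rewrite cm_le_top -(act_le (autV g)) actK cm_le_top. Qed.

Lemma cm_of_lt_top x : cm_of x < cm_top.
Proof.
have [y xy] := uh_ltr x; apply: lt_le_trans (cm_le_top (cm_of y)).
by rewrite lt_cm_of.
Qed.

Lemma cm_bot_lt_of x : cm_bot < cm_of x.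
Proof.
have [y xy] := uh_ltl x; apply: le_lt_trans (cm_bot_le (cm_of y)) _.
by rewrite lt_cm_of.
Qed.

Lemma cm_dense p q : p < q -> exists x, p < cm_of x /\ cm_of x < q.
Proof.
move=> pq; have [x [px xq]] := lt_cm_witness pq.
have [|] := ltP (cm_of x) q; first by exists x.
move=> /(conj xq)/andP/le_anti xqE; rewrite -xqE.
(* Here x is q itself, so a smaller point above p is needed: density of X gives it when p is a
   point, the missing minimum of the upper part when p is a gap. *)
case: p px {pq} => A [[a AE]|Ag] px.
  have pa : exist (fun L => cmpt L) A (or_introl (ex_intro _ a AE)) = cm_of a by exact: cm_inj.
  move: px; rewrite pa lt_cm_of => /uh_dense[z [az zx]].
  by exists z; rewrite !lt_cm_of.
have nAx : ~ A x by move: px => /[swap] Ax; rewrite ltNge => /negP; apply; apply/cm_of_leP.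
have [y [nAy yx]] := (proj2 (proj2 Ag)) x nAx; exists y; rewrite lt_cm_of; split => //.
by rewrite ltNge; apply/negP => /cm_of_leP.
Qed.

Lemma seq_max (s : seq (cm X)) :
  exists m, (m = cm_bot \/ m \in s) /\ forall l, l \in s -> l <= m.
Proof.
elim: s => [|a s [m [ms mP]]]; first by exists cm_bot; split => //; left.
have [am|ma] := leP a m.
  exists m; split => [|l]; first by case: ms => ms; [left|right; rewrite inE ms orbT].
  by rewrite inE => /predU1P[->|/mP].
exists a; split => [|l]; first by right; rewrite mem_head.
by rewrite inE => /predU1P[->|/mP/le_trans]//; apply; exact: ltW.
Qed.

Lemma seq_min (s : seq (cm X)) :
  exists m, (m = cm_top \/ m \in s) /\ forall l, l \in s -> m <= l.
Proof.
elim: s => [|a s [m [ms mP]]]; first by exists cm_top; split => //; left.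
have [am|ma] := leP m a.
  exists m; split => [|l]; first by case: ms => ms; [left|right; rewrite inE ms orbT].
  by rewrite inE => /predU1P[->|/mP].
exists a; split => [|l]; first by right; rewrite mem_head.
rewrite inE => /predU1P[->|/mP]//; apply: le_trans; exact: ltW.
Qed.

(** Density separates the maximum of [ls] from the minimum of [us]. The first two hypotheses cover
    an empty list, whose extremum defaults to [cm_bot] or [cm_top]. *)
Lemma seq_between (ls us : seq (cm X)) :
  (forall l, l \in ls -> l < cm_top) -> (forall u, u \in us -> cm_bot < u) ->
  (forall l u, l \in ls -> u \in us -> l < u) ->
  exists x, (forall l, l \in ls -> l < cm_of x) /\ (forall u, u \in us -> cm_of x < u).
Proof.
move=> lsT usB lsus.
have [m [mE mP]] := seq_max ls; have [n [nE nP]] := seq_min us.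
have mn : m < n.
  case: mE => [->|mE]; case: nE => [->|nE]; [|exact: usB|exact: lsT|exact: lsus].
  by have [x _] := infinite_notin [::]; exact: lt_trans (cm_bot_lt_of x) (cm_of_lt_top x).
have [x [mx xn]] := cm_dense mn; exists x; split => l.
  by move=> /mP lm; exact: le_lt_trans mx.
by move=> /nP; exact: lt_le_trans.
Qed.

(* Every set of cuts has a supremum: the union of the cuts, completed by its least
   upper bound in X when that union is neither a point nor a gap. *)
Lemma cm_sup (S : set (cm X)) :
  exists s, (forall p, S p -> p <= s) /\ (forall q, q < s -> exists p, S p /\ q < p).
Proof.
pose U := [set x | exists p, S p /\ proj1_sig p x].
have Ud x y : y <= x -> U x -> U y by move=> yx [p [Sp px]]; exists p; split=> //;
  exact: cm_down px.
(* Density of the points in the chain of cuts reduces the supremum property to conditions on points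
   of X. *)
suff [s sU] : exists s : cm X, (forall x, U x -> proj1_sig s x) /\
    (forall x, cm_of x < s -> U x).
  exists s; split => [p Sp|q qs]; first by apply/lecmE => x px; apply: sU.1; exists p.
  have [x [qx xs]] := cm_dense qs; have [p [Sp /cm_of_leP xp]] := sU.2 x xs.
  by exists p; split=> //; exact: lt_le_trans xp.
have [[b [nUb bmin]]|nmin] := pselect (exists b, ~ U b /\ forall y, ~ U y -> b <= y).
  exists (cm_of b); split => x; last first.
    by rewrite lt_cm_of => xb; apply: contrapT => /bmin; rewrite leNgt xb.
  move=> Ux /=; rewrite leNgt; apply/negP => bx; apply: nUb; apply: Ud Ux; exact: ltW.
have [[a [Ua amax]]|nmax] := pselect (exists a, U a /\ forall y, U y -> y <= a).
  exists (cm_of a); split => x; first exact: amax.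
  by rewrite lt_cm_of => /ltW xa; exact: Ud Ua.
have gU : isgap U.
  split; first exact: Ud.
  split=> x hx; apply: contrapT => nx; [apply: nmax|apply: nmin]; exists x; split=> // y Uy;
    rewrite leNgt; apply/negP => xy; apply: nx; by exists y.
exists (exist _ U (or_intror gU)); split => // x /ltW /cm_of_leP; exact.
Qed.

(** * Extension of automorphisms with prescribed behaviour on finitely many cuts *)

(** With z the preimage of y under t, it suffices to find h fixing Q with h x = z and to take t h.
    The hypotheses put x and z on the same side of every cut of Q. *)
Lemma aut_step t (Q : seq (cm X)) x y : cm_of x \notin Q ->
  (forall q, q \in Q -> q < cm_of x -> actcm t q < cm_of y) ->
  (forall q, q \in Q -> cm_of x < q -> cm_of y < actcm t q) ->
  exists t', (forall q, q \in Q -> actcm t' q = actcm t q) /\ proj1_sig t' x = y.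
Proof.
move=> xQ Qlt Qgt; pose z := proj1_sig (autV t) y.
have tz : actcm t (cm_of z) = cm_of y by rewrite act_cm_of autVK.
(* The point a lies above the cuts of Q below x, yet below both x and z; b is its mirror image on
   the other side. *)
have [||q v|a [aP1 aP2]] := @seq_between [seq q <- Q | q < cm_of x] [:: cm_of x; cm_of z].
- by move=> q; rewrite mem_filter => /andP[qx _]; exact: lt_le_trans qx (cm_le_top _).
- by move=> v; rewrite !inE => /orP[]/eqP ->; exact: cm_bot_lt_of.
- rewrite mem_filter !inE => /andP[qx qQ] /orP[]/eqP -> //.
  by rewrite -(act_lt t) tz; exact: Qlt.
have [||v q|b [bP1 bP2]] := @seq_between [:: cm_of x; cm_of z] [seq q <- Q | cm_of x < q].
- by move=> v; rewrite !inE => /orP[]/eqP ->; exact: cm_of_lt_top.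
- by move=> q; rewrite mem_filter => /andP[qx _]; exact: le_lt_trans (cm_bot_le _) qx.
- rewrite mem_filter !inE => /orP[]/eqP -> /andP[qx qQ] //.
  by rewrite -(act_lt t) tz; exact: Qgt.
have ax : a < x by rewrite -lt_cm_of; apply: aP2; rewrite !inE eqxx.
have az : a < z by rewrite -lt_cm_of; apply: aP2; rewrite !inE eqxx orbT.
have xb : x < b by rewrite -lt_cm_of; apply: bP1; rewrite !inE eqxx.
have zb : z < b by rewrite -lt_cm_of; apply: bP1; rewrite !inE eqxx orbT.
have [||g [ga gx gb]] := @uh_aut [:: a; x; b] [:: a; z; b] erefl.
  by rewrite /= ax xb.
  by rewrite /= az zb.
have [h [hin hout]] := aut_splice ga gb.
exists (autM t h); split => [q qQ|/=]; last first.
  by rewrite hin ?gx ?autVK// !ltW.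
rewrite actM; congr actcm.
have [qx|xq|qE] := ltgtP q (cm_of x); last by rewrite -qE qQ in xQ.
  apply: (@act_fix_lt _ _ _ a); last by apply: aP1; rewrite mem_filter qx.
  by move=> w wa; apply: hout; rewrite negb_and -ltNge wa.
apply: (@act_fix_gt _ _ _ b); last by apply: bP2; rewrite mem_filter xq.
  by move=> w bw; apply: hout; rewrite negb_and -!ltNge bw orbT.
by rewrite hin ?gb// lexx ltW// (lt_trans ax).
Qed.

(** Induction on s, freezing one cut at a time: once placed, c i joins Q and t is replaced. Since c
    i may be a gap, it is trapped between two points whose images are prescribed. The index type
    allows the moved cuts to be points of X or arbitrary cuts. *)
Lemma aut_approx (I : eqType) (c A B : I -> cm X) (s : seq I) t (Q : seq (cm X)) :
  (forall i, i \in s -> cm_bot < c i /\ c i < cm_top) ->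
  (forall i j, i \in s -> j \in s -> c i <= c j -> A i < B j) ->
  (forall q i, q \in Q -> i \in s -> q <= c i -> actcm t q < B i) ->
  (forall q i, q \in Q -> i \in s -> c i <= q -> A i < actcm t q) ->
  exists g, (forall q, q \in Q -> actcm g q = actcm t q) /\
    forall i, i \in s -> A i < actcm g (c i) /\ actcm g (c i) < B i.
Proof.
elim: s t Q => [|i s IH] t Q cP AB QB QA; first by exists t; split.
have sub j : j \in s -> j \in i :: s by rewrite inE orbC => ->.
have is0 : i \in i :: s by exact: mem_head.
set p := c i; have [pbot ptop] := cP i is0.
(* If p is already frozen, [QA] and [QB] put its image under t in the required interval. *)
have [pQ|pQ] := boolP (p \in Q).
  have [||||g [gQ gs]] := IH t Q; try by [move=> j /sub /cP | move=> j k /sub js /sub; exact: AB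
    | move=> q j qQ /sub; exact: QB | move=> q j qQ /sub; exact: QA].
  exists g; split => // j; rewrite inE => /predU1P[->|/gs//].
  by rewrite -/p gQ//; split; [exact: QA|exact: QB].
(* The image of p must also respect the intervals of the other indices; these bounds keep the
   hypotheses true once p joins Q. *)
pose ls := [seq A j | j <- i :: s & c j <= p] ++ [seq actcm t q | q <- Q & q < p].
pose us := [seq B j | j <- i :: s & p <= c j] ++ [seq actcm t q | q <- Q & p < q].
have lsP l : l \in ls -> (exists j, [/\ l = A j, j \in i :: s & c j <= p]) \/
    (exists q, [/\ l = actcm t q, q \in Q & q < p]).
  rewrite mem_cat => /orP[]/mapP[j]; rewrite mem_filter => /andP[jp jI] ->;
    by [left; exists j|right; exists j].
have usP l : l \in us -> (exists j, [/\ l = B j, j \in i :: s & p <= c j]) \/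
    (exists q, [/\ l = actcm t q, q \in Q & p < q]).
  rewrite mem_cat => /orP[]/mapP[j]; rewrite mem_filter => /andP[jp jI] ->;
    by [left; exists j|right; exists j].
have usB v : v \in us -> cm_bot < v.
  move=> /usP[[j [-> js _]]|[q [-> qQ pq]]].
    by apply: le_lt_trans (cm_bot_le (A j)) _; exact: AB.
  by rewrite -(act_bot t) act_lt; exact: lt_trans pq.
have [||l v|y1 [y1l y1u]] := @seq_between ls us.
- move=> l /lsP[[j [-> js _]]|[q [-> qQ qp]]].
    by apply: lt_le_trans (cm_le_top (B j)); exact: AB.
  by rewrite -(act_top t) act_lt; exact: lt_trans ptop.
- exact: usB.
- move=> /lsP[[j [-> js jp]]|[q [-> qQ qp]]] /usP[[k [-> ks pk]]|[r [-> rQ pr]]].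
  + by apply: AB => //; exact: le_trans pk.
  + by apply: QA => //; exact: le_trans (ltW pr).
  + by apply: QB => //; exact: le_trans (ltW qp) pk.
  + by rewrite act_lt; exact: lt_trans pr.
(* Two values y1 < y2 are needed: the image of p will fall strictly between them. *)
have [||l v|y2 [y2l y2u]] := @seq_between [:: cm_of y1] us.
- by move=> l; rewrite inE => /eqP ->; exact: cm_of_lt_top.
- exact: usB.
- by rewrite inE => /eqP -> /y1u.
have y12 : cm_of y1 < cm_of y2 by apply: y2l; rewrite inE.
(* The points w1 < p < w2 enclose p so tightly that no cut of Q lies between them. *)
have [||l v|w1 [w1l /(_ p (mem_head _ _)) w1p]] := @seq_between [seq q <- Q | q < p] [:: p].
- by move=> l; rewrite mem_filter => /andP[lp _]; exact: lt_trans ptop.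
- by move=> l; rewrite inE => /eqP ->.
- by rewrite mem_filter inE => /andP[lp _] /eqP ->.
have [||l v|w2 [/(_ p (mem_head _ _)) pw2 w2u]] := @seq_between [:: p] [seq q <- Q | p < q].
- by move=> l; rewrite inE => /eqP ->.
- by move=> l; rewrite mem_filter => /andP[pl _]; exact: lt_trans pl.
- by rewrite mem_filter inE => /eqP -> /andP[lp _].
have lt_w1 q : q \in Q -> q < p -> q < cm_of w1 by move=> qQ qp; apply: w1l; rewrite mem_filter qp.
have gt_w2 q : q \in Q -> p < q -> cm_of w2 < q by move=> qQ qp; apply: w2u; rewrite mem_filter qp.
have neqp q : q \in Q -> q < p \/ p < q.
  by move=> qQ; apply/orP; rewrite -neq_lt; apply: contraNneq pQ => <-.
have gt_p q : q \in Q -> cm_of w1 <= q -> p < q.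
  by move=> qQ w1q; case: (neqp q qQ) => // /(lt_w1 q qQ)/(le_lt_trans w1q); rewrite ltxx.
have lt_p q : q \in Q -> q <= cm_of w2 -> q < p.
  by move=> qQ qw2; case: (neqp q qQ) => // /(gt_w2 q qQ)/lt_le_trans/(_ qw2); rewrite ltxx.
have in_ls q : q \in Q -> q < p -> actcm t q < cm_of y1.
  move=> qQ qp; apply: y1l; rewrite mem_cat; apply/orP; right.
  by apply/mapP; exists q; rewrite // mem_filter qp.
have in_us q : q \in Q -> p < q -> cm_of y2 < actcm t q.
  move=> qQ qp; apply: y2u; rewrite mem_cat; apply/orP; right.
  by apply/mapP; exists q; rewrite // mem_filter qp.
(* First w1 is sent to y1; it is then frozen while w2 is sent to y2. *)
have [|q qQ qw1|q qQ w1q|t1 [t1Q t1w]] := @aut_step t Q w1 y1.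
- by apply/negP => w1Q; have := gt_p _ w1Q (lexx _); rewrite ltNge (ltW w1p).
- by apply: in_ls => //; exact: lt_trans w1p.
- by apply: lt_trans y12 _; apply: in_us => //; apply: gt_p => //; exact: ltW.
have w12 : cm_of w1 < cm_of w2 by exact: lt_trans pw2.
have [|q qQ qw1|q qQ w1q|t2 [t2Q t2w]] := @aut_step t1 (cm_of w1 :: Q) w2 y2.
- rewrite inE negb_or gt_eqF//=; apply/negP => w2Q.
  by have := lt_p _ w2Q (lexx _); rewrite ltNge (ltW pw2).
- move: qQ; rewrite inE => /predU1P[->|qQ]; first by rewrite act_cm_of t1w.
  rewrite t1Q//; apply: lt_trans y12; apply: in_ls => //; apply: lt_p => //; exact: ltW.
- move: qQ; rewrite inE => /predU1P[qE|qQ]; first by move: w1q; rewrite qE ltNge (ltW w12).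
  by rewrite t1Q//; apply: in_us => //; exact: lt_trans w1q.
have t2p1 : cm_of y1 < actcm t2 p by rewrite -t1w -act_cm_of -t2Q ?mem_head// act_lt.
have t2p2 : actcm t2 p < cm_of y2 by rewrite -t2w -act_cm_of act_lt.
have t2t q : q \in Q -> actcm t2 q = actcm t q.
  by move=> qQ; rewrite t2Q ?t1Q// inE qQ orbT.
have y1A j : j \in i :: s -> c j <= p -> A j < cm_of y1.
  move=> js jp; apply: y1l; rewrite mem_cat; apply/orP; left.
  by apply/mapP; exists j; rewrite // mem_filter jp.
have y2B j : j \in i :: s -> p <= c j -> cm_of y2 < B j.
  move=> js jp; apply: y2u; rewrite mem_cat; apply/orP; left.
  by apply/mapP; exists j; rewrite // mem_filter jp.
(* From here on p is frozen together with Q. *)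
have [j /sub /cP //|j k /sub js /sub|q j qQ js qj|q j qQ js jq|g [gQ gs]] := IH t2 (p :: Q).
- exact: AB.
- move: qQ qj; rewrite inE => /predU1P[->|qQ] qj; last by rewrite t2t//; apply: QB => //;
  exact: sub.
  by apply: lt_trans t2p2 _; apply: y2B => //; exact: sub.
- move: qQ jq; rewrite inE => /predU1P[->|qQ] jq; last by rewrite t2t//; apply: QA => //;
  exact: sub.
  by apply: lt_trans t2p1; apply: y1A => //; exact: sub.
exists g; split => [q qQ|j]; first by rewrite gQ ?t2t// inE qQ orbT.
rewrite inE => /predU1P[->|/gs//]; rewrite -/p gQ ?mem_head//; split.
  by apply: lt_trans t2p1; exact: y1A.
by apply: lt_trans t2p2 _; exact: y2B.
Qed.

(** * Neighbourhoods *)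

(** Taking endpoints among the cuts lets unbounded intervals end at [cm_bot] and [cm_top], so no
    optional bounds are carried along. *)
Lemma nbhd_eP (O : set (Aut X)) : nbhd_e O <->
  exists (s : seq X) (A B : X -> cm X), (forall x, A x < cm_of x /\ cm_of x < B x) /\
    (forall g, (forall x, x \in s -> A x < cm_of (proj1_sig g x) /\
                                     cm_of (proj1_sig g x) < B x) -> O g).
Proof.
split=> [[F [U [/finite_seqP[s ->] [FU UO]]]]|[s [A [B [AB ABO]]]]]; last first.
  exists [set` s], (fun x => [set y | A x < cm_of y /\ cm_of y < B x]).
  split; first by apply/finite_seqP; exists s.
  split=> // x _; split=> [y /= [Ay yB]|]; last exact: AB.
  have [a [Aa ay]] := cm_dense Ay; have [b [yb bB]] := cm_dense yB.
  rewrite !lt_cm_of in ay yb.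
  exists (Some a), (Some b); split=> [|z [/(_ _ erefl) az /(_ _ erefl) zb]].
    by split=> _ [<-].
  by split; [apply: lt_trans Aa _|apply: lt_trans bB]; rewrite lt_cm_of.
have /choice[AB ABP] x : exists AB : cm X * cm X, (AB.1 < cm_of x /\ cm_of x < AB.2) /\
    (x \in s -> forall y, AB.1 < cm_of y -> cm_of y < AB.2 -> U x y).
  have [xs|] := boolP (x \in s); last first.
    by exists (cm_bot, cm_top); split; [split; [exact: cm_bot_lt_of|exact: cm_of_lt_top]|].
  have [Uo Ux] := FU x xs; have [a [b [[ax xb] abU]]] := Uo x Ux.
  exists (oapp (@cm_of _ X) cm_bot a, oapp (@cm_of _ X) cm_top b); split=> [|_ y /= ay yb].
    split=> /=; [case: a ax {abU}|case: b xb {abU}] => /=.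
    - by move=> a /(_ _ erefl); rewrite lt_cm_of.
    - by move=> _; exact: cm_bot_lt_of.
    - by move=> b /(_ _ erefl); rewrite lt_cm_of.
    - by move=> _; exact: cm_of_lt_top.
  apply: abU; split=> c E; [move: ay; rewrite E|move: yb; rewrite E]; by rewrite /= lt_cm_of.
exists s, (fun x => (AB x).1), (fun x => (AB x).2); split=> [x|g gs].
  exact: (ABP x).1.
by apply: UO => x xs; have [] := gs x xs; exact: (ABP x).2.
Qed.

Lemma nbhd_e1 (O : set (Aut X)) : nbhd_e O -> O aut1.
Proof. by move=> /nbhd_eP[s [A [B [AB]]]]; apply => x _; exact: AB. Qed.

Lemma nbhd_eT : nbhd_e (@setT (Aut X)).
Proof. by exists set0, (fun=> setT); split; [exact: finite_set0|]. Qed.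

Lemma nbhd_eI (O O' : set (Aut X)) : nbhd_e O -> nbhd_e O' -> nbhd_e (O `&` O').
Proof.
move=> /nbhd_eP[s [A [B [AB ABO]]]] /nbhd_eP[s' [A' [B' [AB' ABO']]]].
apply/nbhd_eP;
  exists (s ++ s'), (fun x => Order.max (A x) (A' x)), (fun x => Order.min (B x) (B' x)).
split=> [x|g gs].
  by rewrite gt_max lt_min; have [-> ->] := AB x; have [-> ->] := AB' x.
split; [apply: ABO => x xs|apply: ABO' => x xs]; have [] := gs x; rewrite ?mem_cat ?xs ?orbT//;
  by rewrite gt_max lt_min => /andP[? ?] /andP[].
Qed.

Lemma nbhd_e_gt a x : a < cm_of x -> nbhd_e [set g : Aut X | a < cm_of (proj1_sig g x)].
Proof.
move=> ax; apply/nbhd_eP; exists [:: x], (fun y => if y == x then a else cm_bot), (fun=> cm_top).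
split=> [y|g /(_ x (mem_head _ _))]; last by rewrite eqxx => -[].
by split; [case: eqP => [->//|_]; exact: cm_bot_lt_of|exact: cm_of_lt_top].
Qed.

Lemma nbhd_e_lt b x : cm_of x < b -> nbhd_e [set g : Aut X | cm_of (proj1_sig g x) < b].
Proof.
move=> xb; apply/nbhd_eP; exists [:: x], (fun=> cm_bot), (fun y => if y == x then b else cm_top).
split=> [y|g /(_ x (mem_head _ _))]; last by rewrite eqxx => -[].
by split; [exact: cm_bot_lt_of|case: eqP => [->//|_]; exact: cm_of_lt_top].
Qed.

Lemma oopen_oint (a b : option (cm X)) : oopen (@ltcm _ X) (oint (@ltcm _ X) a b).
Proof. by move=> p abp; exists a, b. Qed.

Lemma oopen_gt a : oopen (@ltcm _ X) [set q | a < q].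
Proof.
move=> p ap; exists (Some a), None; split=> [|q [/(_ _ erefl)/ltcmE]//].
by split=> // _ [<-]; exact/ltcmE.
Qed.

Lemma oopen_lt b : oopen (@ltcm _ X) [set q | q < b].
Proof.
move=> p ap; exists None, (Some b); split=> [|q [_ /(_ _ erefl)/ltcmE]//].
by split=> // _ [<-]; exact/ltcmE.
Qed.

Lemma oopenT : oopen (@ltcm _ X) setT.
Proof. by move=> p _; exists None, None. Qed.

Lemma oopenI (U V : set (cm X)) :
  oopen (@ltcm _ X) U -> oopen (@ltcm _ X) V -> oopen (@ltcm _ X) (U `&` V).
Proof.
move=> Uo Vo p [Up Vp]; have [a [b [[ap pb] abU]]] := Uo p Up.
have [a' [b' [[ap' pb'] abV]]] := Vo p Vp.
have [a2 a2P] : exists a2 : option (cm X), forall q, (forall c, a2 = Some c -> ltcm c q) <->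
    (forall c, a = Some c -> ltcm c q) /\ (forall c, a' = Some c -> ltcm c q).
  case: a {abU ap} => [a|]; last by exists a' => q; split=> [|[]].
  case: a' {abV ap'} => [a'|]; last by exists (Some a) => q; split=> [|[]].
  exists (Some (Order.max a a')) => q; split=> [/(_ _ erefl)/ltcmE|].
    by rewrite gt_max => /andP[? ?]; split=> _ [<-]; exact/ltcmE.
  by move=> [/(_ _ erefl)/ltcmE aq /(_ _ erefl)/ltcmE aq'] _ [<-]; apply/ltcmE; rewrite gt_max aq.
have [b2 b2P] : exists b2 : option (cm X), forall q, (forall c, b2 = Some c -> ltcm q c) <->
    (forall c, b = Some c -> ltcm q c) /\ (forall c, b' = Some c -> ltcm q c).
  case: b {abU pb} => [b|]; last by exists b' => q; split=> [|[]].
  case: b' {abV pb'} => [b'|]; last by exists (Some b) => q; split=> [|[]].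
  exists (Some (Order.min b b')) => q; split=> [/(_ _ erefl)/ltcmE|].
    by rewrite lt_min => /andP[? ?]; split=> _ [<-]; exact/ltcmE.
  by move=> [/(_ _ erefl)/ltcmE aq /(_ _ erefl)/ltcmE aq'] _ [<-]; apply/ltcmE; rewrite lt_min aq.
exists a2, b2; split=> [|q [/a2P[? ?] /b2P[? ?]]]; first by split; [exact/a2P|exact/b2P].
by split; [exact: abU|exact: abV].
Qed.

(** A missing endpoint becomes [cm_bot] or [cm_top], which costs the extreme cut itself; hence the
    alternatives to strict inequality, needed when p is extreme. *)
Lemma oopen_itv (U : set (cm X)) p : oopen (@ltcm _ X) U -> U p ->
  exists A B, [/\ A < p \/ A = cm_bot, p < B \/ B = cm_top, A <= p, p <= B &
    forall q, A < q -> q < B -> U q].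
Proof.
move=> Uo Up; have [a [b [[ap pb] abU]]] := Uo p Up.
exists (odflt cm_bot a), (odflt cm_top b); split.
- by case: a ap {abU} => [a /(_ _ erefl)/ltcmE|_]; [left|right].
- by case: b pb {abU} => [b /(_ _ erefl)/ltcmE|_]; [left|right].
- by case: a ap {abU} => [a /(_ _ erefl)/ltcmE/ltW|_] //; exact: cm_bot_le.
- by case: b pb {abU} => [b /(_ _ erefl)/ltcmE/ltW|_] //; exact: cm_le_top.
- by move=> q aq qb; apply: abU; split=> c E; apply/ltcmE; [move: aq|move: qb]; rewrite E.
Qed.

Lemma diag_nbhd_open (D : set (cm X * cm X)) p : diag_nbhd (@ltcm _ X) D ->
  exists U, [/\ oopen (@ltcm _ X) U, U p & forall q r, U q -> U r -> D (q, r)].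
Proof.
move=> /(_ p)[U [V [Uo [Vo [Up [Vp UVD]]]]]]; exists (U `&` V); split=> //.
  exact: oopenI.
by move=> q r [Uq _] [_ Vr]; exact: UVD.
Qed.

Lemma diag_nbhdI (D E : set (cm X * cm X)) :
  diag_nbhd (@ltcm _ X) D -> diag_nbhd (@ltcm _ X) E -> diag_nbhd (@ltcm _ X) (D `&` E).
Proof.
move=> hD hE p; have [U [Uo Up UD]] := diag_nbhd_open p hD.
have [V [Vo Vp VE]] := diag_nbhd_open p hE.
exists (U `&` V), (U `&` V); do 2![split; first exact: oopenI]; do 2!split=> //.
by move=> q r [Uq Vq] [Ur Vr]; split; [exact: UD|exact: VE].
Qed.

(** * Compactness and its uniform consequences *)

(* Compactness of the chain of cuts in the form of an induction on open covers. *)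
Lemma cm_compact_ind (P : set (cm X) -> Prop) :
  (forall U V, U `<=` V -> P V -> P U) ->
  (forall U V, P U -> P V -> P (U `|` V)) ->
  (forall p, exists U, [/\ oopen (@ltcm _ X) U, U p & P U]) ->
  P setT.
Proof.
(* The supremum s of the cuts whose closed lower ray satisfies P has a neighbourhood U satisfying P,
   which extends such rays past s. *)
move=> Psub PU Ploc; have [s [sub slub]] := cm_sup [set c | P [set q | q <= c]].
have [U [Uo Us PUs]] := Ploc s; have [a [b [[as_ sb] abU]]] := Uo s Us.
have sv v : b = Some v -> s < v by move=> /sb/ltcmE.
have Ps : P [set q | q <= s].
  case: a as_ abU => [a /(_ _ erefl)/ltcmE as_|_] abU.
    have [c [Pc ac]] := slub a as_; apply: Psub (PU _ _ Pc PUs) => q /= qs.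
    have [qc|cq] := leP q c; [by left|right; apply: abU; split=> [_ [<-]|v E]].
      by apply/ltcmE; exact: lt_trans cq.
    by apply/ltcmE; apply: le_lt_trans qs _; exact: sv.
  apply: Psub PUs => q /= qs; apply: abU; split=> // v E.
  by apply/ltcmE; apply: le_lt_trans qs _; exact: sv.
have ext (V : set (cm X)) : (forall q, V q -> forall v, b = Some v -> q < v) -> P V.
  move=> Vb; apply: Psub (PU _ _ Ps PUs) => q Vq.
  have [qs|sq] := leP q s; [by left|right; apply: abU; split=> v E]; apply/ltcmE.
    by apply: lt_trans sq; exact/ltcmE/as_.
  exact: Vb E.
(* If U had an upper endpoint b, a point y between s and b would give a ray satisfying P beyond the
   supremum. *)
case: b sb {abU sv} ext => [b /(_ _ erefl)/ltcmE sb|_] ext; last exact: ext.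
have [y [sy yb]] := cm_dense sb.
have /sub : P [set q | q <= cm_of y] by apply: ext => q qy _ [<-]; exact: le_lt_trans yb.
by rewrite leNgt sy.
Qed.

(** Near a cut p it suffices to control one point of X on each side, since automorphisms are
    monotone; compactness merges finitely many such conditions. *)
Lemma nbhd_e_uniform (D : set (cm X * cm X)) : diag_nbhd (@ltcm _ X) D ->
  exists O : set (Aut X), nbhd_e O /\
    forall o o', O o -> O o' -> forall q, D (actcm o q, actcm o' q).
Proof.
move=> Dn; suff [O [On OD]] : exists O : set (Aut X), nbhd_e O /\
    forall o o', O o -> O o' -> forall q, [set: cm X] q -> D (actcm o q, actcm o' q).
  by exists O; split=> // o o' Oo Oo' q; exact: OD.
pattern [set: cm X]; apply: cm_compact_ind => [U V UV [O [On OD]]|U V [O [On OD]] [O' [On' OD']]|p].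
- by exists O; split=> // o o' Oo Oo' q /UV; exact: OD.
- exists (O `&` O'); split; first exact: nbhd_eI.
  by move=> o o' [? ?] [? ?] q [Uq|Vq]; [exact: OD|exact: OD'].
have [U [Uo Up UD]] := diag_nbhd_open p Dn; have [a [b [[ap pb] abU]]] := Uo p Up.
have [a' [O1 [O1n ap' O1P]]] : exists (a' : option (cm X)) (O1 : set (Aut X)),
   [/\ nbhd_e O1, forall v, a' = Some v -> ltcm v p & forall o q, O1 o ->
    (forall v, a' = Some v -> ltcm v q) -> (forall v, a = Some v -> ltcm v (actcm o q))].
  case: a ap {abU} => [a /(_ _ erefl)/ltcmE ap|_]; last by exists None, setT; split=> //;
    exact: nbhd_eT.
  have [x [ax xp]] := cm_dense ap.
  exists (Some (cm_of x)), [set g | a < cm_of (proj1_sig g x)]; split; first exact: nbhd_e_gt.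
    by move=> _ [<-]; exact/ltcmE.
  move=> o q ao /(_ _ erefl)/ltcmE xq _ [<-]; apply/ltcmE.
  by apply: lt_trans ao _; rewrite -act_cm_of act_lt.
have [b' [O2 [O2n pb' O2P]]] : exists (b' : option (cm X)) (O2 : set (Aut X)),
   [/\ nbhd_e O2, forall v, b' = Some v -> ltcm p v & forall o q, O2 o ->
    (forall v, b' = Some v -> ltcm q v) -> (forall v, b = Some v -> ltcm (actcm o q) v)].
  case: b pb {abU} => [b /(_ _ erefl)/ltcmE pb|_]; last by exists None, setT; split=> //;
    exact: nbhd_eT.
  have [x [px xb]] := cm_dense pb.
  exists (Some (cm_of x)), [set g | cm_of (proj1_sig g x) < b]; split; first exact: nbhd_e_lt.
    by move=> _ [<-]; exact/ltcmE.
  move=> o q ob /(_ _ erefl)/ltcmE qx _ [<-]; apply/ltcmE.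
  by apply: lt_trans ob; rewrite -act_cm_of act_lt.
exists (oint (@ltcm _ X) a' b'); split; [exact: oopen_oint|by split|].
exists (O1 `&` O2); split; first exact: nbhd_eI.
move=> o o' [? ?] [? ?] q [aq qb]; apply: UD; apply: abU; split; by [exact: O1P|exact: O2P].
Qed.

Lemma finite_small_cover (D : set (cm X * cm X)) : diag_nbhd (@ltcm _ X) D ->
  exists cs : seq (set (cm X)), (forall q, exists C, C \in cs /\ C q) /\
    forall C, C \in cs -> forall q r, C q -> C r -> D (q, r).
Proof.
move=> Dn; suff [cs [cov csD]] : exists cs : seq (set (cm X)),
   (forall q, [set: cm X] q -> exists C, C \in cs /\ C q) /\
    forall C, C \in cs -> forall q r, C q -> C r -> D (q, r).
  by exists cs; split=> // q; exact: cov.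
pattern [set: cm X]; apply: cm_compact_ind =>
  [U V UV [cs [cov csD]]|U V [cs [cov csD]] [cs' [cov' csD']]|p].
- by exists cs; split=> // q /UV; exact: cov.
- exists (cs ++ cs'); split=> [q [/cov|/cov'][C [Cc Cq]]|C].
  + by exists C; rewrite mem_cat Cc.
  + by exists C; rewrite mem_cat Cc orbT.
  + by rewrite mem_cat => /orP[/csD|/csD'].
have [U [Uo Up UD]] := diag_nbhd_open p Dn; exists U; split=> //.
exists [:: U]; split=> [q Uq|C]; first by exists U; rewrite inE eqxx.
by rewrite inE => /eqP ->.
Qed.

(** * Comparison of the uniformities *)

Local Notation Vcm := (Vunif (@ltcm _ X) (@actcm _ X)).
Local Notation Rcm := (RSigma (@actcm _ X)).

(** The stabilizer factor can be solved for as k^-1 o^-1 g, so membership depends only on the values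
    on sigma. *)
Lemma in_OgS_StP (O : set (Aut X)) (sigma : set (cm X)) k g :
  in_OgS O k (St (@actcm _ X) sigma) g <->
  exists o, O o /\ forall p, sigma p -> actcm g p = actcm o (actcm k p).
Proof.
split=> [[o [s [Oo [Ss gE]]]]|[o [Oo gE]]].
  exists o; split=> // p sp; rewrite -[in RHS](Ss p sp) -!actM.
  by apply: act_eq => x; rewrite gE.
exists o, (autM (autV k) (autM (autV o) g)); split=> //; split=> [p sp|].
  by rewrite !actM gE// !actK.
by apply/funext => x /=; rewrite !autVK.
Qed.

Lemma Vunif_sub_RSigma : Vcm `<=` Rcm.
Proof.
move=> W [F [D [Ffin [Dn DW]]]]; have [O [On OD]] := nbhd_e_uniform Dn.
(* F may be empty; adding [cm_bot] makes sigma nonempty. *)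
exists O, (F `|` [set cm_bot]); split=> //; split; last split.
- by rewrite finite_setU; split=> //; exact: finite_set1.
- by exists cm_bot; right.
move=> g h [k [/in_OgS_StP[o [Oo oE]] /in_OgS_StP[o' [Oo' oE']]]].
by apply: DW => p Fp; rewrite oE ?oE'; [exact: OD|left|left].
Qed.

(** An entourage tailored to [aut_approx]: its two clauses are the conditions on a frozen cut and
    its image. *)
Lemma diag_nbhd_sep (s : seq X) (A B : X -> cm X) :
  (forall x, A x < cm_of x /\ cm_of x < B x) ->
  diag_nbhd (@ltcm _ X) [set qr | forall x, x \in s ->
    (qr.1 <= cm_of x -> qr.2 < B x) /\ (cm_of x <= qr.1 -> A x < qr.2)].
Proof.
move=> AB; elim: s => [p|x s IH].
  by exists setT, setT; do 2![split; first exact: oopenT].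
have hx : diag_nbhd (@ltcm _ X) [set qr |
    (qr.1 <= cm_of x -> qr.2 < B x) /\ (cm_of x <= qr.1 -> A x < qr.2)].
  move=> p; have [Ax xB] := AB x; have [px|xp|->] := ltgtP p (cm_of x).
  - exists [set q | q < cm_of x], [set q | q < cm_of x].
    do 2![split; first exact: oopen_lt]; do 2!split=> //.
    move=> q r /= qx rx; split=> [_|]; first exact: lt_trans xB.
    by rewrite leNgt qx.
  - exists [set q | cm_of x < q], [set q | cm_of x < q].
    do 2![split; first exact: oopen_gt]; do 2!split=> //.
    move=> q r /= qx rx; split=> [|_]; last exact: lt_trans rx.
    by rewrite leNgt qx.
  - exists setT, ([set q | A x < q] `&` [set q | q < B x]).
    split; first exact: oopenT.
    split; first by apply: oopenI; [exact: oopen_gt|exact: oopen_lt].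
    by split=> //; split=> // q r _ [].
move=> p; have [U [V [Uo [Vo [Up [Vp UVP]]]]]] := diag_nbhdI hx IH p.
exists U, V; do 4!split=> //; move=> q r Uq Vr y.
by have [/= h1 h2] := UVP q r Uq Vr; rewrite inE => /predU1P[->|/h2].
Qed.

Lemma RSigma_sub_Vunif : Rcm `<=` Vcm.
Proof.
move=> W [O [sigma [/nbhd_eP[s [A [B [AB ABO]]]] [/finite_seqP[sg ->] [_ OW]]]]].
exists [set` sg]; eexists; split; first by apply/finite_seqP; exists sg.
split; first exact: (diag_nbhd_sep s AB).
move=> g h gh; apply: OW; exists g; split; apply/in_OgS_StP.
  exists aut1; split=> [|p _]; last by rewrite act1.
  by apply: ABO => x _; exact: AB.
(* With k = g, what remains is some o in O agreeing with h g^-1 on the cuts g p. These cuts are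
   frozen, and the points of s are moved into their intervals. *)
pose t := autM h (autV g).
have tg p : actcm t (actcm g p) = actcm h p by rewrite actM actK.
have [x _|x y _ _ xy|q x|q x|o [oQ os]] := @aut_approx X (@cm_of _ X) A B s t (map (actcm g) sg).
- by split; [exact: cm_bot_lt_of|exact: cm_of_lt_top].
- by apply: lt_le_trans (AB x).1 _; apply: le_trans xy _; exact: ltW (AB y).2.
- by move=> /mapP[p psg ->] xs; rewrite tg; exact: (gh p psg x xs).1.
- by move=> /mapP[p psg ->] xs; rewrite tg; exact: (gh p psg x xs).2.
exists o; split; first by apply: ABO => x /os; rewrite act_cm_of.
by move=> p psg; rewrite oQ ?tg//; apply/mapP; exists p.
Qed.

Lemma Vunif_RSigma : Vcm = Rcm.
Proof. by apply/seteqP; split; [exact: Vunif_sub_RSigma|exact: RSigma_sub_Vunif]. Qed.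

(** * The Roelcke uniformity and total boundedness *)

(** The stabilizer of the finitely many points defining O is contained in O, so O k St is contained
    in O k O. *)
Lemma Roelcke_sub_RSigma : @Roelcke _ X `<=` Rcm.
Proof.
move=> W [O [On OW]]; have [s [A [B [AB ABO]]]] := (nbhd_eP O).1 On.
exists O, ([set` map (@cm_of _ X) s] `|` [set cm_bot]); split=> //; split; last split.
- rewrite finite_setU; split; last exact: finite_set1.
  by apply/finite_seqP; eexists.
- by exists cm_bot; right.
have StO u : St (@actcm _ X) ([set` map (@cm_of _ X) s] `|` [set cm_bot]) u -> O u.
  move=> uS; apply: ABO => x xs; rewrite -act_cm_of uS; first exact: AB.
  by left; exact: map_f.
move=> g h [k [[o [u [? [/StO ? ?]]]] [o' [u' [? [/StO ? ?]]]]]]; apply: OW.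
by exists k; split; [exists o, u|exists o', u'].
Qed.

Lemma Vunif_totally_bounded : totally_bounded Vcm.
Proof.
move=> W [F [D [/finite_seqP[s ->] [Dn DW]]]]; have [cs [cov csD]] := finite_small_cover Dn.
(* Nets are sought inside an arbitrary S, so that the induction can split S by the small set
   containing the image of p. *)
suff fin (S : set (Aut X)) : exists G : set (Aut X), finite_set G /\ G `<=` S /\
    forall g, S g -> exists f, G f /\ forall p, p \in s -> D (actcm f p, actcm g p).
  have [G [Gfin [_ GP]]] := fin setT; exists G; split=> // g.
  by have [f [Gf fP]] := GP g I; exists f; split=> //; exact: DW.
elim: s {DW} S => [|p s IH] S.
  have [[g Sg]|nS] := pselect (exists g, S g); last first.
    by exists set0; split; [exact: finite_set0|split=> // g Sg; case: nS; exists g].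
  exists [set g]; split; first exact: finite_set1.
  by split=> [_ ->//|h _]; exists g.
have /choice[G GP] C := IH (S `&` [set g | C (actcm g p)]).
exists (\bigcup_(C in [set` cs]) G C); split; last split.
- by apply: bigcup_finite => [|C _]; [apply/finite_seqP; exists cs|exact: (GP C).1].
- by move=> g [C _ /(GP C).2.1[]].
move=> g Sg; have [C [Cc Cg]] := cov (actcm g p).
have [f [Gf fP]] := (GP C).2.2 g (conj Sg Cg); exists f; split; first by exists C.
move=> q; rewrite inE => /predU1P[->|/fP//].
by apply: csD Cc _ _ _ Cg; have [] := (GP C).2.1 f Gf.
Qed.

Lemma uh_Roelcke_precompact : @Roelcke_precompact _ X.
Proof. by move=> W /Roelcke_sub_RSigma/RSigma_sub_Vunif; exact: Vunif_totally_bounded. Qed.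

(* A small s moving x and an arbitrary g: the pair (g, g s) is Roelcke-small, but
   g can stretch x < s x to any prescribed pair u < v. *)
Lemma Roelcke_proper : @Roelcke _ X `<` Vcm.
Proof.
split; first by move=> W /Roelcke_sub_RSigma/RSigma_sub_Vunif.
move=> VR; have [x _] := infinite_notin [::]; have [v xv] := uh_ltr x.
(* D is an entourage that omits the pair (x, v). *)
pose D := [set qr : cm X * cm X | (qr.1 < cm_of v /\ qr.2 < cm_of v) \/
                                  (cm_of x < qr.1 /\ cm_of x < qr.2)].
have Dn : diag_nbhd (@ltcm _ X) D.
  move=> p; have [pv|vp] := ltP p (cm_of v).
    exists [set q | q < cm_of v], [set q | q < cm_of v].
    by do 2![split; first exact: oopen_lt]; do 2!split=> //; move=> q r ? ?; left.
  exists [set q | cm_of x < q], [set q | cm_of x < q].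
  have xp : cm_of x < p by apply: lt_le_trans vp; rewrite lt_cm_of.
  by do 2![split; first exact: oopen_gt]; do 2!split=> //; move=> q r ? ?; right.
have [|O [On OW]] := VR [set gh | D (actcm gh.1 (cm_of x), actcm gh.2 (cm_of x))].
  exists [set cm_of x], D; split; first exact: finite_set1.
  by split=> // g h; apply.
have [s [A [B [AB ABO]]]] := (nbhd_eP O).1 On.
(* The point y is above x, in the interval of x and below every larger point of s, so x can move to
   y while the other points of s stay fixed. *)
have [||l q|y [/(_ _ (mem_head _ _)) xy yP]] :=
    @seq_between [:: cm_of x] (B x :: [seq cm_of z | z <- s & x < z]).
- by move=> l; rewrite inE => /eqP ->; exact: cm_of_lt_top.
- move=> l; rewrite inE => /predU1P[->|/mapP[z _ ->]]; last exact: cm_bot_lt_of.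
  exact: lt_trans (cm_bot_lt_of x) (AB x).2.
- rewrite inE => /eqP ->; rewrite inE => /predU1P[->|/mapP[z]]; first exact: (AB x).2.
  by rewrite mem_filter => /andP[xz _] ->; rewrite lt_cm_of.
have yB : cm_of y < B x by apply: yP; exact: mem_head.
have [|q /mapP[z]|q /mapP[z]|u [uQ ux]] :=
    @aut_step aut1 (map (@cm_of _ X) [seq z <- s | z != x]) x y.
- by apply/mapP => -[z]; rewrite mem_filter => /andP[/eqP zx _] /cm_of_inj/esym.
- by rewrite act1 => _ _ qx; exact: lt_trans xy.
- rewrite act1 mem_filter => /andP[_ zs] -> xz; apply: yP; rewrite inE; apply/orP; right.
  by apply: map_f; rewrite mem_filter zs andbT -lt_cm_of.
have Ou : O u.
  apply: ABO => z zs; have [->|zx] := eqVneq z x.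
    by rewrite ux; split=> //; apply: lt_trans xy; exact: (AB x).1.
  rewrite -act_cm_of uQ ?act1; first exact: AB.
  by apply: map_f; rewrite mem_filter zx.
rewrite lt_cm_of in xy.
(* As g fixes x and stretches y to v, the maps g and g u send x to x and to v. *)
have [||g [gx gy]] := @uh_aut [:: x; y] [:: x; v] erefl; rewrite /= ?xy ?xv//.
have O1 := nbhd_e1 On.
have : D (actcm g (cm_of x), actcm (autM g u) (cm_of x)).
  apply: (OW g (autM g u)); exists g.
  by split; [exists aut1, aut1|exists aut1, u].
rewrite actM !act_cm_of ux gx gy => -[[_]|[]] /=; by rewrite ltxx.
Qed.

(** * The Ellis compactification as a set of monotone maps *)

(** Each listed property is closed: a violation is an open condition at one or two cuts, which some
    automorphism would share. Conversely, [aut_approx] started at the identity with nothing frozen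
    approximates a monotone map on finitely many cuts. *)
Lemma Ellis_cmE : Ellis (@ltcm _ X) (@actcm _ X) =
  [set f : cm X -> cm X |
     (forall p q, ltcm p q -> lecm (f p) (f q)) /\
     (forall p, proj1_sig p = set0 -> f p = p) /\
     (forall p, proj1_sig p = setT -> f p = p)].
Proof.
apply/seteqP; split=> [f fE|f [fm [f0 fT]]].
  split; last split.
  - move=> p q /ltcmE pq; apply/lecmE; rewrite leNgt; apply/negP => fqp.
    have [x [qx xp]] := cm_dense fqp.
    have qp : q != p by rewrite gt_eqF.
    have [||g gP] := fE [set p; q]
      (fun r => if r == p then [set u | cm_of x < u] else [set u | u < cm_of x]).
    + by rewrite finite_setU; split; exact: finite_set1.
    + move=> _ [->|->]; first by rewrite eqxx; split=> //; exact: oopen_gt.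
      by rewrite (negbTE qp); split=> //; exact: oopen_lt.
    have := gP p (or_introl erefl); have := gP q (or_intror erefl).
    rewrite eqxx (negbTE qp) /= => gqx xgp.
    by have := lt_trans gqx xgp; rewrite act_lt ltNge (ltW pq).
  - move=> p p0; have -> : p = cm_bot by exact: cm_inj.
    apply/eqP; rewrite eq_le cm_bot_le andbT leNgt; apply/negP => lt.
    have [||g gP] := fE [set cm_bot] (fun=> [set u | cm_bot < u]).
    + exact: finite_set1.
    + by move=> _ ->; split=> //; exact: oopen_gt.
    by have := gP _ erefl; rewrite /= act_bot ltxx.
  - move=> p pT; have -> : p = cm_top by exact: cm_inj.
    apply/eqP; rewrite eq_le cm_le_top /= leNgt; apply/negP => lt.
    have [||g gP] := fE [set cm_top] (fun=> [set u | u < cm_top]).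
    + exact: finite_set1.
    + by move=> _ ->; split=> //; exact: oopen_lt.
    by have := gP _ erefl; rewrite /= act_top ltxx.
move=> F U /finite_seqP[s ->] FU.
have fbot : f cm_bot = cm_bot by exact: f0.
have ftop : f cm_top = cm_top by exact: fT.
have {}fm p q : p <= q -> f p <= f q.
  by rewrite le_eqVlt => /predU1P[->//|/ltcmE/fm/lecmE].
have /choice[AB ABP] p : exists AB : cm X * cm X, p \in s ->
   [/\ AB.1 < f p \/ AB.1 = cm_bot, f p < AB.2 \/ AB.2 = cm_top, AB.1 <= f p, f p <= AB.2 &
    forall q, AB.1 < q -> q < AB.2 -> U p q].
  have [ps|] := boolP (p \in s); last by exists (cm_bot, cm_bot).
  by have [Uo Up] := FU p ps; have [A [B ABP]] := oopen_itv Uo Up; exists (A, B).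
(* The two extreme cuts are left out of the list: f and all automorphisms fix them. *)
have [p|p q|//|//|g [_ gP]] := @aut_approx _ id (fun p => (AB p).1) (fun p => (AB p).2)
    [seq p <- s | (p != cm_bot) && (p != cm_top)] aut1 [::].
- rewrite mem_filter => /andP[/andP[pb pt] _].
  by rewrite !lt_neqAle cm_bot_le cm_le_top pt eq_sym pb.
- rewrite !mem_filter => /andP[_ /ABP[[Al|A0] _ Ale _ _]] /andP[_ /ABP[_ Bg _ Bge _]] pq.
    by apply: lt_le_trans Al _; exact: le_trans (fm _ _ pq) Bge.
  rewrite A0; case: Bg => [fqB|->]; first exact: le_lt_trans (cm_bot_le _) fqB.
  by have [x _] := infinite_notin [::]; exact: lt_trans (cm_bot_lt_of x) (cm_of_lt_top x).
exists g => p ps; have [pE|pb] := eqVneq p cm_bot.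
  by have := (FU p ps).2; rewrite pE fbot act_bot.
have [pE|pt] := eqVneq p cm_top.
  by have := (FU p ps).2; rewrite pE ftop act_top.
have [|gl gr] := gP p; first by rewrite mem_filter pb pt.
by have [_ _ _ _] := ABP p ps; exact.
Qed.

(** * Continuously ordered chains *)

Lemma in_OgS_sub (O S S' : set (Aut X)) k g :
  S `<=` S' -> in_OgS O k S g -> in_OgS O k S' g.
Proof. by move=> SS' [o [u [Oo [/SS' Su gE]]]]; exists o, u. Qed.

(** Every cut is a point of X or one of the two ends, and automorphisms fix the ends, so stabilizers
    of finite sets of cuts come from finite sets of points. *)
Lemma continuously_ordered_RSigma : @continuously_ordered _ X ->
  Rcm = RSigma (fun (g : Aut X) (x : X) => proj1_sig g x).
Proof.
move=> [_ gaps]; apply/seteqP; split=> W [O [sigma [On [sfin [[z0 sz0] OW]]]]].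
- have [x0 _] := infinite_notin [::].
  (* The ends are sent to an arbitrary x0, which keeps the image of sigma nonempty even if sigma
     contains only ends. *)
  have /choice[f fP] (p : cm X) : exists x, forall y, p = cm_of y -> x = y.
    have [[x ->]|np] := pselect (exists x, p = cm_of x); first by exists x => y /cm_of_inj.
    by exists x0 => y pE; case: np; exists y.
  exists O, (f @` sigma); split=> //; split; first exact: finite_image.
  split; first by exists (f z0), z0.
  move=> g h [k [gk hk]]; apply: OW; exists k.
  suff sub : St (fun (g : Aut X) (x : X) => proj1_sig g x) (f @` sigma) `<=`
      St (@actcm _ X) sigma by split; exact: in_OgS_sub sub _.
  move=> u uS p sp; have [[y pE]|/gaps[]p0] := svalP p.
  + have {}pE : p = cm_of y by exact: cm_inj.
    by rewrite pE act_cm_of uS//; exists p => //; exact: fP.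
  + have -> : p = cm_bot by exact: cm_inj.
    exact: act_bot.
  + have -> : p = cm_top by exact: cm_inj.
    exact: act_top.
exists O, (@cm_of _ X @` sigma); split=> //; split; first exact: finite_image.
split; first by exists (cm_of z0), z0.
move=> g h [k [gk hk]]; apply: OW; exists k.
suff sub : St (@actcm _ X) (@cm_of _ X @` sigma) `<=`
    St (fun (g : Aut X) (x : X) => proj1_sig g x) sigma by split; exact: in_OgS_sub sub _.
by move=> u uS z sz; apply: cm_of_inj; rewrite -act_cm_of uS//; exists z.
Qed.

End Homogeneous.

Theorem mainTheorem13 (d : Order.disp_t) (X : orderType d)
  (Xinf : infinite_set [set: X]) (Xuh : ultrahomogeneous X) :
  (* (a) V_G = R_{Sigma_{c_m X}} *)
  Vunif (@ltcm _ X) (@actcm _ X) = RSigma (@actcm _ X) /\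
  (* (b) G Roelcke precompact and b_r G < e_{c_m X} G strictly *)
  (@Roelcke_precompact _ X /\ @Roelcke _ X `<` Vunif (@ltcm _ X) (@actcm _ X)) /\
  (* (c) e_{c_m X} G = non-decreasing self-maps of c_m X fixing inf and sup *)
  Ellis (@ltcm _ X) (@actcm _ X) =
    [set f : cm X -> cm X |
       (forall p q, ltcm p q -> lecm (f p) (f q)) /\
       (forall p, proj1_sig p = set0 -> f p = p) /\
       (forall p, proj1_sig p = setT -> f p = p)] /\
  (* continuously ordered case: V_G = R_{Sigma_X} *)
  (@continuously_ordered _ X ->
     Vunif (@ltcm _ X) (@actcm _ X) = RSigma (fun (g : Aut X) (x : X) => proj1_sig g x)).
Proof.
split; first exact: Vunif_RSigma.
split; first by split; [exact: uh_Roelcke_precompact|exact: Roelcke_proper].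
split; first exact: Ellis_cmE.
by rewrite Vunif_RSigma//; exact: continuously_ordered_RSigma.
Qed.
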